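(* Let $F$ be a field, $L\ge 1$ an integer, and for $i=1,\ldots,L$ let $b^{(i)}(x),m^{(i)}(x)\in F[x]$ with $n^{(i)}:=\deg m^{(i)}(x)\ge 1$ and $\deg b^{(i)}(x)<n^{(i)}$, and let $\tau^{(i)}\in\mathbb{Z}$ with $0\le\tau^{(i)}\le n^{(i)}$. Let $\Lambda(x)$ be the solution (unique up to a nonzero scale factor) of the SPI problem with data $b^{(i)}(x),m^{(i)}(x),\tau^{(i)}$, and let $u$ be an integer satisfying both $u\ge\deg\Lambda(x)$ and $n^{(i)}-\tau^{(i)}+u>0$ for all $i\in\{1,\ldots,L\}$. Let $\tilde b^{(i)}(x)$ be defined from $b^{(i)}(x),m^{(i)}(x),\tau^{(i)},u$ as in the context. Then the modified SPI problem in which $b^{(i)}(x)$, $m^{(i)}(x)$, and $\tau^{(i)}$ are replaced by $\tilde b^{(i)}(x)$, $x^{n^{(i)}-\tau^{(i)}+u}$, and $u$, respectively (for all $i$), has the same solution $\Lambda(x)$ as the original SPI problem. In addition, for all $i\in\{1,\ldots,L\}$, $$b^{(i)}(x)\Lambda(x)\ \mathrm{div}\ m^{(i)}(x)=\tilde b^{(i)}(x)\Lambda(x)\ \mathrm{div}\ x^{n^{(i)}-\tau^{(i)}+u}.$$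
   Context: For polynomials, $a(x)\bmod m(x)$ and $a(x)\ \mathrm{div}\ m(x)$ denote the remainder and the quotient of the division of $a(x)$ by $m(x)$. The degree of the zero polynomial is $-\infty$. SPI problem: given $b^{(i)}(x),m^{(i)}(x)\in F[x]$ with $\deg m^{(i)}(x)\ge1$, $\deg b^{(i)}(x)<\deg m^{(i)}(x)$ and integers $0\le\tau^{(i)}\le\deg m^{(i)}(x)$, $i=1,\ldots,L$, find a nonzero polynomial $\Lambda(x)\in F[x]$ of the smallest degree such that $\deg\big(b^{(i)}(x)\Lambda(x)\bmod m^{(i)}(x)\big)<\tau^{(i)}$ for all $i\in\{1,\ldots,L\}$. A solution always exists and is unique up to a nonzero scale factor in $F$. Definition of $\tilde b^{(i)}(x)$: let $\overline b^{(i)}(x):=x^{n^{(i)}-1}b^{(i)}(x^{-1})$ and $\overline m^{(i)}(x):=x^{n^{(i)}}m^{(i)}(x^{-1})$. Let $w^{(i)}(x)$ be the inverse of $\overline m^{(i)}(x)\bmod x^{n^{(i)}-\tau^{(i)}+u}$ in the ring $F[x]/x^{n^{(i)}-\tau^{(i)}+u}$ (it exists since $\overline m^{(i)}(0)\ne0$). Let $s^{(i)}(x):=\big(w^{(i)}(x)\overline b^{(i)}(x)\big)\bmod x^{n^{(i)}-\tau^{(i)}+u}$, and finally $\tilde b^{(i)}(x):=x^{n^{(i)}-\tau^{(i)}+u-1}s^{(i)}(x^{-1})$. *)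

(* Defs.v *)
From HB Require Import structures.
From mathcomp Require Import all_boot all_order all_algebra.

Set Implicit Arguments.
Unset Strict Implicit.
Unset Printing Implicit Defensive.

Import GRing.Theory.
Local Open Scope ring_scope.

(* As [size p] is [deg p + 1], and [size 0 = 0] matches deg 0 = -oo,
   [deg p < t] is written [size p <= t] for a natural number [t]. *)

Section SPI.
Variables (F : fieldType) (L : nat).
Implicit Types (b m : 'I_L -> {poly F}) (tau : 'I_L -> nat) (la : {poly F}).

(* The last bound is tau <= deg m; the bound 0 <= tau is carried by [nat]. *)
Definition spi_data b m tau : Prop :=
  forall i, [/\ (1 < size (m i))%N, (size (b i) < size (m i))%N
              & (tau i <= (size (m i)).-1)%N].

Definition spi_feasible b m tau la : Prop :=
  la != 0 /\ forall i, (size ((b i * la) %% m i)%R <= tau i)%N.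

Definition spi_solution b m tau la : Prop :=
  spi_feasible b m tau la /\
  forall la', spi_feasible b m tau la' -> (size la <= size la')%N.

End SPI.

Section Monomialized.
Variable F : fieldType.
Implicit Types b m p : {poly F}.

(* x^k p(x^-1), meaningful for deg p <= k; otherwise [k - j] truncates. *)
Definition revp (k : nat) p : {poly F} := \sum_(j < size p) p`_j *: 'X^(k - j).

Lemma revpE (k : nat) p : (size p <= k.+1)%N ->
  tofrac (revp k p) =
  tofrac 'X ^+ k * (map_poly (@tofrac _ \o polyC) p).[(tofrac 'X)^-1].
Proof.
move=> lepk; have X0 : tofrac ('X : {poly F}) \is a GRing.unit.
  by rewrite unitfE tofrac_eq0 polyX_eq0.
rewrite /revp raddf_sum horner_coef size_map_poly mulr_sumr.
apply: eq_bigr => j _; have lejk : (j <= k)%N by rewrite -ltnS (leq_trans (ltn_ord j)).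
rewrite coef_map /= -mul_polyC tofracM tofracXn mulrCA; congr (_ * _).
by rewrite exprVn exprB.
Qed.

(* n - tau + u for n = deg m. *)
Definition mono_exp m (tau u : nat) : nat := ((size m).-1 - tau + u)%N.

(* [{poly %/ 'X^N}] is the ring F[x]/x^N when N > 0 (for N = 0 the library
   quotients by 'X instead), and [_^-1] on it is the inverse of units; an
   element of it coerces to its representative of degree < N. *)
Definition btilde b m (tau u : nat) : {poly F} :=
  let n := (size m).-1 in
  let N := mono_exp m tau u in
  let w : {poly %/ 'X^N} := (in_qpoly 'X^N (revp n m))^-1 in
  let s : {poly F} := ((w : {poly F}) * revp n.-1 b) %% 'X^N in
  revp N.-1 s.

End Monomialized.

(* Main.v *)
(* Expand b/m as a power series in 1/x: the polynomial b~ collects its first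
   N = n - tau + u coefficients, i.e. b~ = (x^N b) div m, so m b~ = x^N b - e
   with deg e < n.  Hence, for every polynomial q,
     m (b~ La - x^N q) = x^N (b La - m q) - e La.
   If deg La <= u, then deg (e La) < n + u = N + tau, and the two remainders
   satisfy deg (b La - m q) < tau iff deg (b~ La - x^N q) < u.  So a La of
   degree at most u is feasible for one problem iff it is for the other, with
   the same quotient q; La's of larger degree cannot be minimal. *)
Require Import Defs.
From mathcomp Require Import all_boot all_order all_algebra zify ring.
Set Implicit Arguments.
Unset Strict Implicit.
Unset Printing Implicit Defensive.

Import GRing.Theory.
Local Open Scope ring_scope.

Section Reversal.
Variable F : fieldType.
Implicit Types p q : {poly F}.

Lemma coef_revp k p i : (size p <= k.+1)%N ->
  (revp k p)`_i = if (i <= k)%N then p`_(k - i) else 0.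
Proof.
move=> lepk; rewrite /revp coef_sum.
under eq_bigr => j _ do rewrite coefZ coefXn.
case: leqP => [leik | ltki]; last first.
  rewrite big1 // => j _; suff /negPf-> : (i != k - j)%N by rewrite mulr0.
  by lia.
have [ltp | lep] := ltnP (k - i) (size p).
  rewrite (bigD1 (Ordinal ltp)) //= subKn // eqxx mulr1 big1 ?addr0 // => j.
  rewrite -val_eqE /= => neq; have lejk := leq_trans (ltn_ord j) lepk.
  suff /negPf-> : i != (k - j)%N by rewrite mulr0.
  by apply: contraNneq neq => ->; rewrite subKn.
rewrite nth_default // big1 // => j _; have := ltn_ord j => ltj.
suff /negPf-> : (i != k - j)%N by rewrite mulr0.
by lia.
Qed.

Lemma size_revp k p : (size p <= k.+1)%N -> (size (revp k p) <= k.+1)%N.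
Proof.
move=> lepk; apply/leq_sizeP => i ltki.
by rewrite coef_revp // leqNgt ltki.
Qed.

Lemma revpK k p : (size p <= k.+1)%N -> revp k (revp k p) = p.
Proof.
move=> lepk; apply/polyP => i; rewrite coef_revp ?size_revp //.
case: leqP => [leik | ltki]; last by rewrite nth_default // (leq_trans lepk).
by rewrite coef_revp // leq_subr subKn.
Qed.

Lemma revpD k p q : (size p <= k.+1)%N -> (size q <= k.+1)%N ->
  revp k (p + q) = revp k p + revp k q.
Proof.
move=> lepk leqk; apply/polyP => i.
have lepqk : (size (p + q)%R <= k.+1)%N.
  by rewrite (leq_trans (size_polyD _ _)) // geq_max lepk.
rewrite coefD !coef_revp //; case: ifP => _; last by rewrite addr0.
by rewrite coefD.
Qed.

(** In the fraction field [revp k p] becomes x^k p(1/x), and both the power of x and evaluation at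
    1/x are multiplicative. *)
Lemma revpM k l p q : (size p <= k.+1)%N -> (size q <= l.+1)%N ->
  revp (k + l) (p * q) = revp k p * revp l q.
Proof.
move=> lepk leql; apply/eqP; rewrite -tofrac_eq; apply/eqP.
have lepq : (size (p * q)%R <= (k + l).+1)%N.
  by rewrite (leq_trans (size_polyMleq _ _)) //; lia.
by rewrite tofracM !revpE // rmorphM hornerM exprD mulrACA.
Qed.

Lemma revp1 k : revp k 1 = 'X^k :> {poly F}.
Proof.
by rewrite /revp size_poly1 big_ord1 coef1 scale1r subn0.
Qed.

Lemma revpXn k : revp k 'X^k = 1 :> {poly F}.
Proof. by rewrite -(revp1 k) revpK // size_poly1. Qed.

(** Reversal depends on the declared degree bound: raising it by k costs a factor x^k, which cancels
    against a factor x^k in the argument. *)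
Lemma revp_addl k l p : (size p <= l.+1)%N ->
  revp (k + l) p = 'X^k * revp l p.
Proof. by move=> lepl; rewrite -[p in LHS]mul1r revpM ?size_poly1 ?revp1. Qed.

Lemma revp_XnM k l p : (size p <= l.+1)%N ->
  revp (k + l) ('X^k * p) = revp l p.
Proof. by move=> lepl; rewrite revpM ?size_polyXn // revpXn mul1r. Qed.

End Reversal.

(** A nonzero constant term makes p coprime to x^N, hence a unit of F[x]/x^N, so [^-1] is a true
    inverse here and not a default value. *)
Lemma qpolyXn_mulVp (F : fieldType) (N : nat) (p : {poly F}) :
    (0 < N)%N -> p`_0 != 0 ->
  let w : {poly %/ 'X^N} := (in_qpoly 'X^N p)^-1 in
  ((w : {poly F}) * p) %% 'X^N = 1.
Proof.
case: N => // N _ p0 w.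
(* As N > 0, the modulus really used by the quotient ring is x^N and not the fallback x. *)
have mkE : mk_monic ('X^(N.+1) : {poly F}) = 'X^(N.+1) by rewrite mk_monic_Xn.
have vE q : (in_qpoly 'X^(N.+1) q : {poly F}) = q %% 'X^(N.+1).
  by rewrite /= mkE -Pdiv.IdomainMonic.modpE // monicXn.
have cop : coprimep (mk_monic 'X^(N.+1)) (in_qpoly 'X^(N.+1) p).
  rewrite vE mkE coprimep_modr coprimep_expl //.
  by rewrite coprimep_sym coprimepX rootE horner_coef0.
have := congr1 (fun x : {poly %/ 'X^(N.+1)} => x : {poly F}) (qpoly_mulVz cop).
rewrite poly_of_qpolyM -Pdiv.IdomainMonic.modpE ?monic_mk_monic //.
by rewrite vE [X in _ %% X]mkE modp_mul.
Qed.

Lemma size_mul_leq_add (F : fieldType) (n k : nat) (m p : {poly F}) :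
  size m = n.+1 -> (size (m * p)%R <= n + k)%N = (size p <= k)%N.
Proof.
move=> szm; have [-> | p0] := eqVneq p 0; first by rewrite mulr0 size_poly0.
have m0 : m != 0 by rewrite -size_poly_gt0 szm.
by rewrite size_mul // szm addSn /= leq_add2l.
Qed.

Lemma size_modXn_leq (F : fieldType) (N : nat) (p : {poly F}) :
  (size (p %% 'X^N)%R <= N)%N.
Proof.
by rewrite -ltnS -[X in (_ < X)%N](size_polyXn F) ltn_modp monic_neq0 ?monicXn.
Qed.

Lemma modp_subM (F : fieldType) (p d : {poly F}) : p %% d = p - p %/ d * d.
Proof. by rewrite {2}(divp_eq p d) addrC addKr. Qed.

Lemma divp_sub_small (F : fieldType) (p q d : {poly F}) :
  (size (p - q * d)%R < size d)%N -> q = p %/ d.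
Proof. by apply: divpP; rewrite addrC subrK. Qed.

Section MonomialEquation.
Variables (F : fieldType) (b m : {poly F}) (tau u : nat).
Hypotheses (szm : (1 < size m)%N) (szb : (size b < size m)%N).
Hypothesis ltau : (tau <= (size m).-1)%N.
Hypothesis N_gt0 : (0 < mono_exp m tau u)%N.

Local Notation n := (size m).-1.
Local Notation N := (mono_exp m tau u).
Local Notation bt := (btilde b m tau u).

Let sz_m : size m = n.+1.
Proof. by rewrite prednK // ltnW. Qed.

Let leuN : (u <= N)%N.
Proof. exact: leq_addl. Qed.

(** Exact because tau <= n. This balance makes the bounds tau and u correspond. *)
Let addNtau : (N + tau = n + u)%N.
Proof. by rewrite /mono_exp addnAC subnK. Qed.

Lemma size_btilde : (size bt <= N)%N.
Proof.
rewrite /btilde /= -[X in (_ <= X)%N](prednK N_gt0); apply: size_revp.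
by rewrite prednK // size_modXn_leq.
Qed.

(** By definition s mb = bb modulo x^N. Reversing this congruence turns it into a division of x^N b
    by m, with the reversed cofactor of x^N, negated, as remainder. *)
Lemma btildeE : bt = ('X^N * b) %/ m.
Proof.
have n_gt0 : (0 < n)%N by rewrite -ltnS -sz_m.
set mb := revp n m; set bb := revp n.-1 b.
have le_m : (size m <= n.+1)%N by rewrite -sz_m.
have le_b : (size b <= n.-1.+1)%N by rewrite prednK // -ltnS -sz_m.
(* The constant term of [mb] is the leading coefficient of m. *)
have mb0 : mb`_0 != 0.
  rewrite coef_revp // leq0n subn0 -lead_coefE lead_coef_eq0.
  by rewrite -size_poly_gt0 sz_m.
have := qpolyXn_mulVp N_gt0 mb0; rewrite /=.
set w := (in_qpoly _ _)^-1 => wmb.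
pose wp := w : {poly F}; set s := (wp * bb) %% 'X^N.
have szs : (size s <= N.-1.+1)%N by rewrite prednK // size_modXn_leq.
(* In [t], the first product comes from w mb = 1 + x^N q, the second from the part cut off in
   truncating [s]. *)
pose q := wp * mb %/ 'X^N; pose t := q * bb - wp * bb %/ 'X^N * mb.
have smb : s * mb = bb + 'X^N * t.
  have wmbE : wp * mb = q * 'X^N + 1 by rewrite -wmb -divp_eq.
  rewrite /s /t modp_subM mulrBl mulrAC wmbE; ring.
(* One total degree, split to suit s mb on the left side and x^N t on the right. *)
have addE : (N.-1 + n = N + n.-1)%N by lia.
have szt : (size t <= n.-1.+1)%N.
  rewrite prednK // -(@size_mul_leq_add _ N n 'X^N) ?size_polyXn //.
  have -> : 'X^N * t = s * mb - bb by rewrite smb addrC addKr.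
  rewrite (leq_trans (size_polyD _ _)) // geq_max size_polyN; apply/andP; split.
    rewrite (leq_trans (size_polyMleq _ _)) //.
    rewrite -subn1 leq_subLR (leq_trans (leq_add szs (size_revp le_m))) //.
    by rewrite prednK // addnS.
  by rewrite (leq_trans (size_revp le_b)) // prednK // leq_addl.
apply: (@divpP _ _ _ _ (- revp n.-1 t)); last first.
  by rewrite size_polyN sz_m ltnS -[X in (_ <= X)%N](prednK n_gt0) size_revp.
have := congr1 (revp (N.-1 + n)) smb.
rewrite revpM ?size_revp // {1}/mb revpK // addE revpD.
- rewrite revp_addl ?size_revp // revpK // revp_XnM // => btm.
  by rewrite -[bt]/(revp N.-1 s) btm addrK.
- by rewrite (leq_trans (size_revp le_b)) // ltnS leq_addl.
- by rewrite -addnS size_mul_leq_add ?size_polyXn.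
Qed.

Lemma btilde_eqn : exists2 e, m * bt = 'X^N * b - e & (size e <= n)%N.
Proof.
exists (('X^N * b) %% m).
  by rewrite btildeE mulrC {2}(divp_eq ('X^N * b) m) addrK.
by rewrite -ltnS -sz_m ltn_modp -size_poly_gt0 sz_m.
Qed.

Variable la : {poly F}.
Hypothesis szla : (size la <= u.+1)%N.

Let size_XnM_leq k (p : {poly F}) :
  (size ('X^N * p)%R <= N + k)%N = (size p <= k)%N.
Proof. by apply: size_mul_leq_add; rewrite size_polyXn. Qed.

Let size_errM (e : {poly F}) : (size e <= n)%N -> (size (e * la)%R <= n + u)%N.
Proof.
move=> sze; rewrite (leq_trans (size_polyMleq _ _)) // -subn1 leq_subLR.
by rewrite (leq_trans (leq_add sze szla)) // addnS.
Qed.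

(** Keeping q arbitrary allows the quotient of either division to be inserted before the two are
    known to agree. *)
Lemma btilde_remainder (q : {poly F}) :
  (size (b * la - q * m)%R <= tau)%N = (size (bt * la - q * 'X^N)%R <= u)%N.
Proof.
have [e mbt sze] := btilde_eqn.
(* Scaling by x^N and by m brings both bounds to n + u, which also bounds the error e La. *)
rewrite -(size_XnM_leq tau) addNtau -(size_mul_leq_add u _ sz_m).
have -> : m * (bt * la - q * 'X^N) = 'X^N * (b * la - q * m) - e * la.
  rewrite mulrBr mulrA mbt; ring.
apply/idP/idP => h.
  by rewrite (leq_trans (size_polyD _ _)) // geq_max h size_polyN size_errM.
rewrite -['X^N * _](subrK (e * la)).
by rewrite (leq_trans (size_polyD _ _)) // geq_max h size_errM.
Qed.

Lemma btilde_quotient : (size ((b * la) %% m)%R <= tau)%N ->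
  (b * la) %/ m = (bt * la) %/ 'X^N.
Proof.
rewrite modp_subM btilde_remainder => szr; apply: divp_sub_small.
by rewrite size_polyXn ltnS (leq_trans szr).
Qed.

Lemma btilde_feasible :
  (size ((b * la) %% m)%R <= tau)%N = (size ((bt * la) %% 'X^N)%R <= u)%N.
Proof.
apply/idP/idP => szr.
  by rewrite modp_subM -btilde_quotient // -btilde_remainder -modp_subM.
(* Conversely, the quotient by x^N leaves b La - q m of degree below tau <= n, so it is also the
   quotient by m. *)
have quot : (bt * la) %/ 'X^N = (b * la) %/ m.
  apply: divp_sub_small; rewrite sz_m ltnS (leq_trans _ ltau) //.
  by rewrite btilde_remainder -modp_subM.
by rewrite modp_subM -quot btilde_remainder -modp_subM.
Qed.

End MonomialEquation.

Theorem theorem1 (F : fieldType) (L : nat) (hL : (0 < L)%N)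
    (b m : 'I_L -> {poly F}) (tau : 'I_L -> nat)
    (hdata : spi_data b m tau)
    (Lambda : {poly F}) (hLambda : spi_solution b m tau Lambda)
    (u : nat) (hu : (size Lambda <= u.+1)%N)
    (hN : forall i : 'I_L, (0 < mono_exp (m i) (tau i) u)%N) :
  let bt := fun i : 'I_L => btilde (b i) (m i) (tau i) u in
  let mt := fun i : 'I_L => 'X^(mono_exp (m i) (tau i) u) : {poly F} in
  let taut := fun i : 'I_L => u in
  [/\ spi_data bt mt taut,
      forall la : {poly F},
        spi_solution bt mt taut la <-> spi_solution b m tau la
    & forall i : 'I_L, (b i * Lambda) %/ m i = (bt i * Lambda) %/ mt i].
Proof.
move=> bt mt taut; case: hLambda => feasL minL.
have feasE (la : {poly F}) : (size la <= u.+1)%N ->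
    spi_feasible bt mt taut la <-> spi_feasible b m tau la.
  move=> szla.
  have remE i : (size ((b i * la) %% m i)%R <= tau i)%N =
                (size ((bt i * la) %% mt i)%R <= u)%N.
    by have [szm szb ltau] := hdata i; apply: btilde_feasible.
  by split=> -[la0 hla]; split=> // i; have := hla i; rewrite remE.
split.
- move=> i; have [szm szb ltau] := hdata i; split.
  + by rewrite size_polyXn ltnS hN.
  + by rewrite size_polyXn ltnS size_btilde.
  + by rewrite size_polyXn leq_addl.
- move=> la; split=> -[feas minla].
  (* [Lambda] is feasible for the modified problem too, so a minimal [la] stays within the range of
     [feasE]. *)
  + have szla : (size la <= size Lambda)%N by apply/minla/feasE.
    split; first by apply/feasE; rewrite // (leq_trans szla).
    by move=> la' /minL; apply: leq_trans.
  + have szla : (size la <= u.+1)%N by apply: leq_trans (minla _ feasL) hu.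
    split=> [|la' feas']; first exact/feasE.
    (* Competitors of degree above u escape [feasE] but are longer than [la] anyway. *)
    have [szla' | ltla'] := leqP (size la') u.+1.
      by apply/minla/feasE.
    by rewrite (leq_trans szla) // ltnW.
- move=> i; have [? ? ?] := hdata i; apply: btilde_quotient => //.
  by case: feasL.
Qed.
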